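(* For $n\ge1$ let $\Lambda_n(x)=\sum_{k=1}^n\Lambda(n,k)x^k$ and $L_n(x)=\sum_k L(n,k)x^k$, and set $\Lambda_0(x)=L_0(x)=1$. Then $$\sum_{n\ge0}\Lambda_n(x)\frac{t^n}{n!}=\exp\Big(\sum_{n\ge0}x\,L_n(x^2)\frac{t^{n+1}}{(n+1)!}\Big).$$
   Context: For a permutation $\sigma=\sigma_1\cdots\sigma_n$ of $[n]$, prepend $\sigma_0=0$. An up-down run of $\sigma$ is a maximal segment of consecutive entries of $\sigma_0\sigma_1\cdots\sigma_n$ that is increasing or decreasing (consecutive runs share an endpoint); e.g. $0\,3\,7\,5\,8\,6\,1\,4\,9\,2$ has six up-down runs. $\Lambda(n,k)$ is the number of permutations of $[n]$ with exactly $k$ up-down runs. A left peak of $\sigma$ is an index $i$ with $1\le i\le n-1$ and $\sigma_{i-1}<\sigma_i>\sigma_{i+1}$ (with $\sigma_0=0$); $L(n,k)$ is the number of permutations of $[n]$ with exactly $k$ left peaks. *)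

(* Defs.v *)
From mathcomp Require Import all_boot all_order all_fingroup all_algebra.

Set Implicit Arguments.
Unset Strict Implicit.
Unset Printing Implicit Defensive.

Import GRing.Theory.

(* 'S_n permutes {0, ..., n-1}, so values are shifted by one:
   word s = [:: 0; sigma_1; ...; sigma_n] with sigma_i = s (i-1) + 1. *)
Definition word (n : nat) (s : 'S_n) : seq nat :=
  0%N :: [seq (nat_of_ord (s i)).+1 | i <- enum 'I_n].

Definition entry (n : nat) (s : 'S_n) (i : nat) : nat := nth 0%N (word s) i.

(* sigma_i, ..., sigma_j, both ends included *)
Definition segment (n : nat) (s : 'S_n) (i j : nat) : seq nat :=
  [seq entry s k | k <- iota i (j - i).+1].

Definition monotone_seq (w : seq nat) : bool := sorted ltn w || sorted gtn w.

(* Runs are encoded by their pair of end positions; i < j says that a run has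
   at least two entries. *)
Definition is_updown_run (n : nat) (s : 'S_n) (i j : 'I_n.+1) : bool :=
  [&& (i < j)%N, monotone_seq (segment s i j) &
      [forall i' : 'I_n.+1, forall j' : 'I_n.+1,
         [&& (i' <= i)%N, (j <= j')%N & monotone_seq (segment s i' j')]
         ==> ((i' == i) && (j' == j))]].

Definition updown_runs (n : nat) (s : 'S_n) : nat :=
  #|[set p : 'I_n.+1 * 'I_n.+1 | is_updown_run s p.1 p.2]|.

(* i : 'I_n together with 0 < i is the range 1 <= i <= n - 1. *)
Definition left_peaks (n : nat) (s : 'S_n) : nat :=
  #|[set i : 'I_n | [&& (0 < i)%N, (entry s i.-1 < entry s i)%N &
                        (entry s i.+1 < entry s i)%N]]|.

Definition Lambda (n k : nat) : nat := #|[set s : 'S_n | updown_runs s == k]|.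

Definition L (n k : nat) : nat := #|[set s : 'S_n | left_peaks s == k]|.

Local Open Scope ring_scope.

Definition Lambda_poly (n : nat) : {poly rat} :=
  if n is 0 then 1 else \sum_(1 <= k < n.+1) (Lambda n k)%:R *: 'X^k.

(* left_peaks s <= n, hence the bound on k *)
Definition L_poly (n : nat) : {poly rat} :=
  if n is 0 then 1 else \sum_(0 <= k < n.+1) (L n k)%:R *: 'X^k.

(* Formal power series in t over A, as their sequences of coefficients. *)
Definition fps (A : Type) : Type := nat -> A.

Definition fps_mul (A : algType rat) (f g : fps A) : fps A :=
  fun n => \sum_(i < n.+1) f i * g (n - i)%N.

Definition fps_one (A : algType rat) : fps A := fun n => (n == 0%N)%:R.

Definition fps_pow (A : algType rat) (f : fps A) (m : nat) : fps A :=
  iter m (fps_mul f) (@fps_one A).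

(* exp f = \sum_m f^m / m!, for f with zero constant term; by fps_pow_coef0
   below, only the terms m <= n contribute to the coefficient of t^n. *)
Definition fps_exp (A : algType rat) (f : fps A) : fps A :=
  fun n => \sum_(m < n.+1) (m`!%:R)^-1 *: fps_pow f m n.

Lemma fps_pow_coef0 (A : algType rat) (f : fps A) (m n : nat) :
  f 0%N = 0 -> (n < m)%N -> fps_pow f m n = 0.
Proof.
move=> f0; elim: m n => [|m IHm] n //= lt_nm.
rewrite /fps_mul big1 // => -[[|i] lt_in] _ /=; first by rewrite f0 mul0r.
suff -> : fps_pow f m (n - i.+1)%N = 0 by rewrite mulr0.
apply: IHm; have lt_in' : (i.+1 <= n)%N by [].
by rewrite ltn_subLR // addSnnS (leq_trans lt_nm) // leq_addl.
Qed.

(* \sum_n a_n t^n / n! *)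
Definition egf (A : algType rat) (a : nat -> A) : fps A :=
  fun n => (n`!%:R)^-1 *: a n.

(* Main.v *)
(* Inserting the largest letter n+1 into the words 0 w, w a permutation of [n],
   gives, for D = (x - x^3) d/dx,
     Lambda_(n+1) = (x + n x^2) Lambda_n + D Lambda_n,
     P_(n+1) = (n+1) x^2 P_n + D P_n,   where P_n = x L_n(x^2).
   Both come from one recurrence, because 2 k + 1, for k the number of left
   peaks, is the number of up-down runs of the word 0 w followed by infinity.
   As D is a derivation, these recurrences yield by induction
     Lambda_(n+1) = sum_k binom(n, k) P_k Lambda_(n-k),
   which is the differential equation F' = G' F characterising F = exp G. *)

Require Import Defs.
From mathcomp Require Import all_boot all_order all_fingroup all_algebra.
From mathcomp Require Import ring.

Import Num.Theory.
Import GRing.Theory.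
Local Open Scope ring_scope.

(** * Derivative of the exponential of a power series *)

Lemma invfact_scalerMn (V : lmodType rat) (v : V) m :
  (m.+1`!%:R)^-1 *: (v *+ m.+1) = (m`!%:R)^-1 *: v.
Proof.
rewrite -scaler_nat scalerA factS natrM; congr (_ *: _).
by field; rewrite addrC natr1 !pnatr_eq0 -lt0n fact_gt0.
Qed.

Section FpsExp.
Variables (A : comAlgType rat).
Implicit Types f : fps A.

(** Truncating [f] to a polynomial keeps its low coefficients, so polynomial powers and derivatives
    become available for [fps_pow]. *)
Lemma coef_fps_pow f N m n : (n <= N)%N ->
  ((\poly_(i < N.+1) f i) ^+ m)`_n = fps_pow f m n.
Proof.
elim: m n => [|m IHm] n leN; first by rewrite expr0 coef1.
rewrite exprS coefM /= /fps_mul; apply: eq_bigr => i _.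
have lei : (i <= n)%N by rewrite -ltnS.
by rewrite coef_poly ltnS (leq_trans lei leN) IHm // (leq_trans (leq_subr _ _)).
Qed.

(** Coefficientwise, (f^(m+1))' = (m+1) f' f^m. *)
Lemma fps_pow_deriv f m n :
  fps_pow f m.+1 n.+1 *+ n.+1 =
  (\sum_(i < n.+1) (f i.+1 *+ i.+1) * fps_pow f m (n - i)%N) *+ m.+1.
Proof.
rewrite -(@coef_fps_pow f n.+1 m.+1 n.+1) // -coef_deriv deriv_exp /=.
rewrite coefMn coefM; congr (_ *+ _); apply: eq_bigr => i _.
have lei : (i <= n)%N by rewrite -ltnS.
rewrite coef_deriv coef_poly !ltnS. rewrite lei coef_fps_pow //.
by rewrite (leq_trans (leq_subr _ _)).
Qed.

Lemma fps_exp0 f : fps_exp f 0%N = 1.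
Proof. by rewrite /fps_exp big_ord_recl big_ord0 /= invr1 scale1r addr0. Qed.

(** A common range of [m] for all degrees up to [N] allows the exchange of sums in [fps_expS]. *)
Lemma fps_exp_widen f N n : f 0%N = 0 -> (n <= N)%N ->
  \sum_(m < N.+1) (m`!%:R)^-1 *: fps_pow f m n = fps_exp f n.
Proof.
move=> f0 leN; rewrite /fps_exp
  [RHS](big_ord_widen N.+1 (fun m => (m`!%:R)^-1 *: fps_pow f m n)) //.
rewrite [RHS]big_mkcond /=; apply: eq_bigr => m _.
by case: ltnP => // lt_nm; rewrite fps_pow_coef0 ?scaler0.
Qed.

(** This is (exp f)' = f' exp f. *)
Lemma fps_expS f n : f 0%N = 0 ->
  fps_exp f n.+1 *+ n.+1 =
  \sum_(i < n.+1) (f i.+1 *+ i.+1) * fps_exp f (n - i)%N.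
Proof.
move=> f0; rewrite {1}/fps_exp big_ord_recl /= /fps_one /= scaler0 add0r.
rewrite -sumrMnl.
under [LHS]eq_bigr => m _.
  rewrite scalerMnr /bump add1n -[fps_mul _ _]/(fps_pow f m.+1) fps_pow_deriv.
  rewrite invfact_scalerMn scaler_sumr; over.
rewrite exchange_big /=; apply: eq_bigr => i _.
rewrite -(@fps_exp_widen f n) ?leq_subr // mulr_sumr.
by apply: eq_bigr => m _; rewrite scalerAr.
Qed.

End FpsExp.

(** The recurrence is A' = P A for the exponential generating functions. The exponential of the
    antiderivative of P satisfies it with the same constant term, and strong induction on the degree
    identifies the two. *)
Lemma egf_exp (A : comAlgType rat) (a p : nat -> A) :
  a 0%N = 1 ->
  (forall n, a n.+1 = \sum_(i < n.+1) (p i * a (n - i)%N) *+ 'C(n, i)) ->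
  egf a =1 fps_exp (egf (fun m : nat => if m is n.+1 then p n else 0)).
Proof.
move=> a0 aS n; set f : fps A := egf (fun m => if m is k.+1 then p k else 0).
have f0 : f 0%N = 0 by rewrite /f /egf /= scaler0.
elim/ltn_ind: n => -[|n] IHn; first by rewrite fps_exp0 /egf a0 invr1 scale1r.
have n0 k : k.+1%:R != 0 :> rat by rewrite pnatr_eq0.
apply: (scalerI (n0 n)); rewrite !scaler_nat fps_expS //.
rewrite scalerMnr invfact_scalerMn aS scaler_sumr; apply: eq_bigr => i _.
rewrite -IHn; last by rewrite ltnS leq_subr.
have lei : (i <= n)%N by rewrite -ltnS.
rewrite /f /egf scalerMnr invfact_scalerMn -!scaler_nat !scalerA -scalerAl -scalerAr.
rewrite scalerA; congr (_ *: _).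
rewrite -(bin_fact lei) !natrM.
have fne k : (k`!)%:R != 0 :> rat by rewrite pnatr_eq0 -lt0n fact_gt0.
have bne : ('C(n, i))%:R != 0 :> rat by rewrite pnatr_eq0 -lt0n bin_gt0.
by field; rewrite !fne bne.
Qed.

(** After the Leibniz rule, splitting X + (n+1) X^2 as (i+1) X^2 plus X + (n-i) X^2 turns each
    summand into p_(i+1) a_(n-i) + p_i a_(n-i+1); Pascal's rule recombines them. *)
Lemma binomial_convolution (a p : nat -> {poly rat}) :
  a 0%N = 1 -> p 0%N = 'X ->
  (forall n, a n.+1 = ('X + n%:R * 'X^2) * a n + ('X - 'X^3) * (a n)^`()) ->
  (forall n, p n.+1 = n.+1%:R * 'X^2 * p n + ('X - 'X^3) * (p n)^`()) ->
  forall n, a n.+1 = \sum_(i < n.+1) (p i * a (n - i)%N) *+ 'C(n, i).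
Proof.
move=> a0 p0 aS pS; elim=> [|n IHn].
  by rewrite big_ord1 aS a0 p0 derivC bin0 mulr0 !mulr1 mul0r !addr0.
rewrite aS IHn raddf_sum !mulr_sumr -big_split /=.
transitivity (\sum_(i < n.+1)
  (p i.+1 * a (n - i)%N + p i * a (n - i).+1) *+ 'C(n, i)).
  apply: eq_bigr => i _; rewrite derivMn derivM pS aS.
  have lei : (i <= n)%N by rewrite -ltnS.
  rewrite natrB // !mulrnAr -mulrnDl -!natr1; congr (_ *+ _); ring.
under [LHS]eq_bigr => i _ do rewrite mulrnDl.
rewrite big_split /= [in RHS]big_ord_recl /= bin0 subn0.
under [in RHS]eq_bigr => i _ do rewrite /bump /= add1n binS mulrnDr subSS.
rewrite [in RHS]big_split /= [in RHS]addrA [RHS]addrC; congr (_ + _).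
rewrite big_ord_recl /= bin0 subn0; congr (_ + _).
rewrite [RHS]big_ord_recr /= bin_small // mulr0n addr0.
by apply: eq_bigr => i _; rewrite /bump /= add1n subnSK.
Qed.

(** * Effect of inserting a largest letter on the number of turns *)

(* Number of up-down runs of the word a :: w, not counting the first one if it
   continues a preceding step that is an ascent (b = true) or a descent
   (b = false); e = true appends an infinite letter to the word. *)
Fixpoint turns (e b : bool) (a : nat) (w : seq nat) : nat :=
  if w is c :: w' then ((b != (a < c)) + turns e (a < c) c w')%N
  else (e && ~~ b : nat).

Fixpoint insertions (M : nat) (w : seq nat) : seq (seq nat) :=
  if w is c :: w' then (M :: w) :: [seq c :: v | v <- insertions M w']
  else [:: [:: M]].

Definition turns_poly (e b : bool) (a : nat) (ws : seq (seq nat)) : {poly rat} :=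
  \sum_(w <- ws) 'X^(turns e b a w).

(** For [b = false] and a word of length [n] with [r] turns: [r] of the n+1 insertions keep [r], one
    raises it by 1 unless an infinite letter follows, and the others raise it by 2. *)
Definition insertion_poly (e : bool) (n r : nat) : {poly rat} :=
  r%:R * 'X^r + (~~ e)%:R * 'X^(r.+1) + ((n + e)%N%:R - r%:R) * 'X^(r.+2).

(* In the second identity the extra term on the left is the insertion of [M]
   just before [a]; with it the induction needs no case on whether the step
   after [a] exists or ascends. *)
Lemma turns_poly_insertions e M a w : all (ltn^~ M) (a :: w) ->
  turns_poly e false a (insertions M w)
    = insertion_poly e (size w) (turns e false a w) /\
  turns_poly e true a (insertions M w) + 'X^((turns e false a w).+1)
    = insertion_poly e (size w) (turns e true a w) + 'X^(turns e true a w).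
Proof.
rewrite /turns_poly /insertion_poly.
elim: w a => [|c w IHw] a /= /andP[aM wM].
  rewrite !big_seq1 /= aM.
  by case: e; rewrite /= ?addn0 ?add0n ?expr0 ?expr1; split; ring.
have cM : (c < M)%N by case/andP: wM.
have [IHf IHt] := IHw c wM.
rewrite !big_cons !big_map /= aM ltnNge (ltnW cM) /=.
under eq_bigr do rewrite exprD; under [in X in _ /\ X]eq_bigr do rewrite exprD.
rewrite -!mulr_sumr.
move/(canRL (addrK 'X^((turns e false c w).+1))): IHt => IHt.
case: (a < c)%N => /=; rewrite ?IHf ?IHt;
  move: (turns e false c w) (turns e true c w) => r0 r1;
  rewrite ?add1n ?add0n ?addSn -!natr1 !natrD !exprS; split; ring.
Qed.

(** * Permutations generated by insertion *)

Fixpoint insertion_words (n : nat) : seq (seq nat) :=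
  if n is m.+1 then flatten [seq insertions n w | w <- insertion_words m]
  else [:: [::]].

Lemma size_insertions M w : size (insertions M w) = (size w).+1.
Proof. by elim: w => //= c w IHw; rewrite size_map IHw. Qed.

Lemma perm_insertions M w v : v \in insertions M w -> perm_eq v (M :: w).
Proof.
elim: w v => [|c w IHw] v /=; first by rewrite inE => /eqP->.
rewrite inE => /orP[/eqP-> //|/mapP[u /IHw pu ->]].
by rewrite perm_sym (perm_catCA [:: M] [:: c] w) /= perm_cons perm_sym.
Qed.

Lemma mem_insertions M v1 v2 : v1 ++ M :: v2 \in insertions M (v1 ++ v2).
Proof.
elim: v1 => [|c v1 IHv] /=; first by case: v2 => [|d v2] /=; rewrite inE eqxx.
by rewrite inE orbC (mem_map (f := cons c)) ?IHv // => ? ? [].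
Qed.

Lemma mem_insertion_words n w : (w \in insertion_words n) = perm_eq w (iota 1 n).
Proof.
have iotaE m : perm_eq (iota 1 m.+1) (m.+1 :: iota 1 m).
  by rewrite -(addn1 m) iotaD addn1 perm_catC.
elim: n w => [|n IHn] w.
  by rewrite inE; apply/eqP/idP => [-> //|/perm_nilP].
apply/flatten_mapP/idP => [[u u_n /perm_insertions pw]|pw].
  apply: (perm_trans pw); rewrite perm_sym (perm_trans (iotaE n)) // perm_sym.
  by rewrite perm_cons -IHn.
have : n.+1 \in w by rewrite (perm_mem pw) mem_iota add1n !ltnS leqnn.
move=> M_w; case/splitPr: M_w pw => v1 v2 pw.
exists (v1 ++ v2); last exact: mem_insertions.
rewrite IHn -(perm_cons n.+1); apply: perm_trans (perm_trans pw (iotaE n)).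
by rewrite (perm_catCA [:: n.+1] v1 v2).
Qed.

Lemma size_insertion_words n : size (insertion_words n) = n`!.
Proof.
elim: n => //= n IHn; rewrite size_flatten /shape -map_comp sumnE big_map factS.
rewrite (eq_big_seq (fun=> n.+1)) => [|w] /=.
  by rewrite big_const_seq count_predT iter_addn_0 IHn mulnC.
rewrite mem_insertion_words => /perm_size; rewrite size_iota => <-.
exact: size_insertions.
Qed.

(** The words of permutations are distinct and all occur in [insertion_words n]; as both lists have
    length n!, they agree up to order. *)
Lemma insertion_words_perm n :
  perm_eq (insertion_words n) [seq behead (word s) | s : 'S_n].
Proof.
have inj : injective (fun s : 'S_n => behead (word s)).
  move=> s t /eq_in_map st; apply/permP => i; apply/val_inj/eqP.
  by rewrite -eqSS st ?mem_enum.
have size_eq : size [seq behead (word s) | s : 'S_n] = n`!.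
  by rewrite size_map -cardE card_Sn.
have uS : uniq [seq behead (word s) | s : 'S_n] by rewrite map_inj_uniq ?enum_uniq.
have sub : {subset [seq behead (word s) | s : 'S_n] <= insertion_words n}.
  move=> _ /mapP[s _ ->]; rewrite mem_insertion_words uniq_perm ?iota_uniq //.
    rewrite /= map_inj_uniq ?enum_uniq // => i j [] /val_inj; exact: perm_inj.
  move=> k /=; rewrite mem_iota add1n; apply/mapP/idP => [[i _ ->]|].
    by rewrite /= ltnS ltn_ord.
  case: k => // k; rewrite /= ltnS => lt_kn.
  exists ((s^-1)%g (Ordinal lt_kn)); first by rewrite mem_enum.
  by rewrite permKV.
have le : (size (insertion_words n) <= size [seq behead (word s) | s : 'S_n])%N.
  by rewrite size_eq size_insertion_words.
rewrite perm_sym uniq_perm //; first exact: leq_size_uniq uS sub le.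
by have [] := uniq_min_size uS sub le.
Qed.

(** * Up-down runs counted by their starting positions *)

Section Runs.
Local Open Scope nat_scope.
Variables (n : nat) (s : 'S_n).

Definition ascent (k : nat) : bool := entry s k < entry s k.+1.

Lemma size_word : size (word s) = n.+1.
Proof. by rewrite /= size_map size_enum_ord. Qed.

Lemma word_uniq : uniq (word s).
Proof.
rewrite /= map_inj_uniq ?enum_uniq ?andbT; first by apply/mapP => -[].
by move=> i j [] /val_inj; apply: perm_inj.
Qed.

Lemma descentE k : k < n -> (entry s k.+1 < entry s k) = ~~ ascent k.
Proof.
move=> ltkn; rewrite /ascent -leqNgt ltn_neqAle nth_uniq ?size_word ?ltnS //.
- by rewrite (gtn_eqF (ltnSn k)).
- exact: ltnW.
- exact: word_uniq.
Qed.

Lemma monotone_segmentP (i j : nat) : i <= j <= n ->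
  reflect (exists b, forall k, i <= k < j -> ascent k = b)
          (monotone_seq (segment s i j)).
Proof.
case/andP=> leij lejn.
have srt (r : rel nat) :
  reflect (forall k, i <= k < j -> r (entry s k) (entry s k.+1))
    (sorted r (segment s i j)).
  apply: (iffP (sortedP 0)) => [srt k /andP[leik ltkj]|srt k].
    have := srt (k - i); rewrite size_map size_iota ltnS.
    rewrite ltn_sub2r ?(leq_ltn_trans leik) // => /(_ isT).
    rewrite !(nth_map 0) ?size_iota ?ltnS ?leq_sub2r ?ltn_sub2r //
      ?(leq_ltn_trans leik) //; last exact: ltnW.
    by rewrite !nth_iota ?ltnS ?ltn_sub2r ?(leq_ltn_trans leik)
      ?leq_sub2r ?addnS ?subnKC //; apply: ltnW.
  rewrite size_map size_iota ltnS => ltk.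
  rewrite !(nth_map 0) ?size_iota ?ltnS // ?(ltnW ltk) // !nth_iota ?ltnS ?(ltnW ltk) //.
  by rewrite addnS srt // leq_addr /= -ltn_subRL.
apply: (iffP orP) => [[/srt up|/srt down]|[[] cst]].
- by exists true.
- exists false => k kij; have := down k kij; rewrite /= descentE; first exact: negbTE.
  by case/andP: kij => _ /leq_trans; apply.
- by left; apply/srt => k /cst.
- right; apply/srt => k kij /=; rewrite descentE ?cst //.
  by case/andP: kij => _ /leq_trans; apply.
Qed.

(** A run starts where the direction changes; the value [false] before position 0 makes the initial
    ascent from 0 count as a change. *)
Definition run_start (i : nat) : bool :=
  (if i is k.+1 then ascent k else false) != ascent i.

Lemma run_start_updown_run (i j : 'I_n.+1) :
  is_updown_run s i j -> i < n /\ run_start i.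
Proof.
case/and3P=> ltij mono_ij /forallP max_ij.
have lejn : j <= n by rewrite -ltnS.
have ltin : i < n by apply: leq_trans ltij lejn.
split=> //; rewrite /run_start; case Ei: (nat_of_ord i) => [|k].
  by rewrite /ascent /entry /= (nth_map (Ordinal ltin)) ?size_enum_ord // -Ei.
apply/eqP => asc_eq.
have /monotone_segmentP[|b asc_b] := mono_ij; first by rewrite (ltnW ltij).
have ltkn1 : k < n.+1 by rewrite ltnW // -Ei.
(* Equal directions on both sides of [i] would extend the run one position to the left, against
   maximality. *)
have mono_k : monotone_seq (segment s k j).
  apply/monotone_segmentP.
    by rewrite lejn andbT (leq_trans _ (ltnW ltij)) // Ei.
  exists b => m /andP[]; rewrite leq_eqVlt => /predU1P[<- _|ltkm ltmj].
    by rewrite asc_eq asc_b // -Ei leqnn.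
  by rewrite asc_b // Ei ltkm.
have /forallP/(_ j)/implyP := max_ij (Ordinal ltkn1).
rewrite /= mono_k Ei leqnSn leqnn /= => /(_ isT)/andP[/eqP/(congr1 val) /= ki _].
by move: (ltnSn k); rewrite {1}ki Ei ltnn.
Qed.

(** The witness is the farthest [j] with a monotone segment from [i]; the change of direction at [i]
    blocks any extension to the left. *)
Lemma updown_run_exists (i : 'I_n.+1) : i < n -> run_start i ->
  exists j, is_updown_run s i j.
Proof.
move=> ltin start_i.
pose P (j : 'I_n.+1) := (i < j) && monotone_seq (segment s i j).
have lti1 : i.+1 < n.+1 by [].
have P1 : P (Ordinal lti1).
  rewrite /P /= ltnSn; apply/monotone_segmentP; first by rewrite leqnSn.
  by exists (ascent i) => k; rewrite ltnS -eqn_leq => /eqP->.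
case: (arg_maxnP (fun j : 'I_n.+1 => val j) P1) => j /andP[ltij mono_ij] max_j.
exists j; rewrite /is_updown_run ltij mono_ij.
apply/forallP => i'; apply/forallP => j'; apply/implyP => /and3P[lei lej mono].
have ltij' := leq_trans ltij lej.
have {lei} ii' : i' = i.
  apply/val_inj/eqP; rewrite eqn_leq lei /= leqNgt; apply/negP => lti.
  have /monotone_segmentP[|b asc_b] := mono.
    by rewrite (leq_trans lei (ltnW ltij')) -ltnS ltn_ord.
  move: start_i; rewrite /run_start; case Ei: (nat_of_ord i) => [|k].
    by rewrite Ei in lti.
  rewrite !asc_b ?eqxx // -Ei ?lei // -ltnS -Ei lti /=.
  by rewrite ltnW // -Ei.
rewrite ii' eqxx -val_eqE /= eqn_leq lej andbT; apply: max_j.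
by rewrite /P ltij' -ii'.
Qed.

(** Two runs with the same start are nested, hence equal by maximality. *)
Lemma updown_runsE : updown_runs s = \sum_(i < n) run_start i.
Proof.
rewrite /updown_runs -sum1_card.
have fst_inj : {in [set p | is_updown_run s p.1 p.2] &,
    injective (fun p : 'I_n.+1 * 'I_n.+1 => p.1)}.
  move=> [i j] [i' j']; rewrite !inE /= => /and3P[_ mono /forallP max].
  case/and3P=> _ mono' /forallP max' ii'; rewrite -{}ii' in mono' max' *.
  congr pair; have := leq_total j j'.
  case/orP => lej.
    have /forallP/(_ j')/implyP := max i; rewrite leqnn lej mono'.
    by case/(_ isT)/andP => _ /eqP.
  have /forallP/(_ j)/implyP := max' i; rewrite leqnn lej mono.
  by case/(_ isT)/andP => _ /eqP.
rewrite sum1_card -(card_in_imset fst_inj).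
have -> : [set p.1 | p in [set p | is_updown_run s p.1 p.2]]
        = [set i : 'I_n.+1 | (i < n) && run_start i].
  apply/setP=> i; rewrite inE; apply/imsetP/andP.
    by case=> -[i' j] /=; rewrite inE /= => /run_start_updown_run ? ->.
  by case=> ltin /(updown_run_exists _ ltin)[j ij]; exists (i, j); rewrite ?inE.
rewrite -sum1dep_card big_mkcond /= big_ord_recr /= ltnn addn0.
by apply: eq_bigr => i _; rewrite ltn_ord; case: run_start.
Qed.

End Runs.

(** * Runs and left peaks as turns of a word *)

Lemma turnsE b a w : turns false b a w =
  (\sum_(i < size w) ((if val i is k.+1 then nth 0 (a :: w) k < nth 0 w k else b)
                     != (nth 0 (a :: w) i < nth 0 w i)))%N.
Proof.
elim: w b a => [|c w IHw] b a /=; first by rewrite big_ord0.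
rewrite big_ord_recl IHw /=; congr (_ + _)%N; apply: eq_bigr => -[[|i] lti] _ //=.
Qed.

(** The infinite letter makes the last step an ascent, so each change from ascent to descent pairs
    with the next change back; starting from [b = false] leaves one change to ascent unpaired. *)
Lemma turns_peaks b a w : turns true b a w =
  ((\sum_(i < size w) ((if val i is k.+1 then nth 0 (a :: w) k < nth 0 w k else b)
                      && ~~ (nth 0 (a :: w) i < nth 0 w i))).*2 + ~~ b)%N.
Proof.
elim: w b a => [|c w IHw] b a /=; first by rewrite big_ord0; case: b.
rewrite big_ord_recl IHw /= doubleD -!addnA.
set S := (X in (_ = _ + (X + _))%N).
rewrite (_ : S = (\sum_(i < size w)
  ((if val i is k.+1 then nth 0 (c :: w) k < nth 0 w k else (a < c))
   && ~~ (nth 0 (c :: w) i < nth 0 w i))).*2)%N; last first.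
  by congr _.*2; apply: eq_bigr => -[[|i] lti].
by rewrite addnCA [RHS]addnCA; congr (_ + _)%N; case: b (a < c)%N => [] [].
Qed.

Lemma turns_le_size b a w : (turns false b a w <= size w)%N.
Proof.
elim: w b a => //= c w IHw b a; exact: (leq_add (leq_b1 _) (IHw _ _)).
Qed.

Lemma size_behead_word n (s : 'S_n) : size (behead (word s)) = n.
Proof. by rewrite size_map size_enum_ord. Qed.

Lemma updown_runs_turns n (s : 'S_n) :
  updown_runs s = turns false false 0 (behead (word s)).
Proof. by rewrite updown_runsE turnsE size_behead_word. Qed.

Lemma left_peaks_turns n (s : 'S_n) :
  turns true false 0 (behead (word s)) = (left_peaks s).*2.+1.
Proof.
rewrite turns_peaks size_behead_word addn1; congr _.*2.+1.
rewrite /left_peaks -sum1dep_card [RHS]big_mkcond /=.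
(* At position 0 the direction [b = false] kills the summand, as [0 < i] does in [left_peaks]. *)
apply: eq_bigr => -[[|i] lti] _ //=.
by rewrite descentE // /ascent; case: (_ && _).
Qed.

(** Needed because the sum in [Lambda_poly] starts at k = 1. *)
Lemma updown_runs_gt0 n (s : 'S_n) : (0 < n)%N -> (0 < updown_runs s)%N.
Proof.
move=> n_gt0; rewrite updown_runs_turns.
case E: (behead (word s)) => [|c w] /=.
  by move: n_gt0; rewrite -(size_behead_word _ s) E.
suff -> : (0 < c)%N by [].
have : c \in behead (word s) by rewrite E mem_head.
by case/mapP => i _ ->.
Qed.

(** * Recurrences and generating polynomials *)

(** In [insertion_poly], r X^r - r X^(r+2) is X - X^3 times the derivative of X^r; the other terms
    are X^r times a factor independent of [r]. *)
Lemma turns_poly_insertion_words e n :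
  turns_poly e false 0 (insertion_words n.+1) =
  ((~~ e)%:R * 'X + (n + e)%N%:R * 'X^2) * turns_poly e false 0 (insertion_words n)
  + ('X - 'X^3) * (turns_poly e false 0 (insertion_words n))^`().
Proof.
rewrite /turns_poly /= big_flatten /= big_map raddf_sum /=.
rewrite !mulr_sumr -big_split /= !big_seq; apply: eq_bigr => w.
rewrite mem_insertion_words => pw.
have wn : size w = n by rewrite (perm_size pw) size_iota.
have [|] := @turns_poly_insertions e n.+1 0 w; rewrite /turns_poly;
  last move=> -> _.
  by apply/allP => k; rewrite inE (perm_mem pw) mem_iota => /predU1P[->|/andP[]].
rewrite wn /insertion_poly derivXn.
(* The derivative has exponent [r.-1], so [r = 0] is treated apart. *)
case: (turns _ _ _ _) => [|r] /=; first by rewrite expr0 expr1; ring.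
by rewrite -mulr_natr !exprS -!natr1; ring.
Qed.

Lemma sum_expX_card (T : finType) (f : T -> nat) a b :
  (forall x, (a <= f x < b)%N) ->
  \sum_x 'X^(f x) = \sum_(a <= k < b) #|[set x | f x == k]|%:R *: 'X^k :> {poly rat}.
Proof.
move=> f_ab.
transitivity (\sum_x \sum_(a <= k < b) (f x == k)%:R *: 'X^k : {poly rat}).
  apply: eq_bigr => x _; rewrite (bigD1_seq (f x)) ?iota_uniq ?mem_index_iota //=.
  rewrite eqxx scale1r big1 ?addr0 // => k.
  by rewrite eq_sym => /negbTE ->; rewrite scale0r.
rewrite exchange_big /=; apply: eq_bigr => k _.
rewrite -scaler_suml -natr_sum -sum1dep_card [in RHS]big_mkcond /=.
by congr (_%:R *: _); apply: eq_bigr => x _; case: eqP.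
Qed.

Lemma Lambda_polyE n : Lambda_poly n = turns_poly false false 0 (insertion_words n).
Proof.
case: n => [|n]; first by rewrite /turns_poly big_seq1 expr0.
rewrite /turns_poly (perm_big _ (insertion_words_perm n.+1)) big_map big_enum /=.
under [RHS]eq_bigr do rewrite -updown_runs_turns.
rewrite (@sum_expX_card _ (@updown_runs n.+1) 1 n.+2) // => s.
rewrite updown_runs_gt0 //= ltnS updown_runs_turns.
by rewrite (leq_trans (turns_le_size _ _ _)) ?size_behead_word.
Qed.

Lemma L_polyE n :
  'X * (L_poly n \Po 'X^2) = turns_poly true false 0 (insertion_words n).
Proof.
case: n => [|n].
  by rewrite /turns_poly big_seq1 expr1 /= comp_polyC mulr1.
rewrite /turns_poly (perm_big _ (insertion_words_perm n.+1)) big_map big_enum /=.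
under [RHS]eq_bigr do rewrite left_peaks_turns exprS -mul2n exprM.
rewrite -mulr_sumr; congr (_ * _).
rewrite -(@sum_expX_card _ (@left_peaks n.+1)) => [|s].
  by rewrite raddf_sum /=; apply: eq_bigr => s _; rewrite comp_Xn_poly.
by rewrite /= ltnS (leq_trans (max_card _)) ?card_ord.
Qed.

Theorem theorem3p2 :
  egf Lambda_poly =1
  fps_exp (egf (fun m : nat =>
    if m is n.+1 then 'X * (L_poly n \Po 'X^2) else 0 : {poly rat})).
Proof.
pose P n := 'X * (L_poly n \Po 'X^2).
apply: (@egf_exp _ Lambda_poly P) => //.
apply: (@binomial_convolution Lambda_poly P) => [||n|n] //; rewrite /P.
- by rewrite /= comp_polyC mulr1.
- by rewrite !Lambda_polyE turns_poly_insertion_words mul1r addn0.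
- by rewrite !L_polyE turns_poly_insertion_words mul0r add0r addn1.
Qed.
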